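(* For $a,\lambda\in\mathbb{D}\setminus\{0\}$, let $\phi_a(z)=\frac{a-z}{1-\bar{a}z}$ and $\Phi_{a,\lambda}(z)=\phi_a(\lambda\phi_a(z))$ for $z\in\mathbb{D}$. Then for all $a,\lambda\in\mathbb{D}\setminus\{0\}$ the composition operator $C_{\Phi_{a,\lambda}}$ is not complex symmetric on $H^2(\mathbb{D})$, and therefore the sequence $(\phi_a^n)_{n\in\mathbb{N}}$ of powers of $\phi_a$ is not conjugate-orthogonal in $H^2(\mathbb{D})$.
   Context: $\mathbb{D}$ is the open unit disk in $\mathbb{C}$ and $\mathbb{N}=\{0,1,2,\dots\}$. $H^2(\mathbb{D})$ is the Hardy space of analytic functions $f(z)=\sum_{n\ge 0}\widehat f(n)z^n$ on $\mathbb{D}$ with $\sum_n|\widehat f(n)|^2<\infty$, a Hilbert space with inner product $\langle f,g\rangle=\sum_n\widehat f(n)\overline{\widehat g(n)}$. For an analytic self-map $\phi$ of $\mathbb{D}$, the composition operator is $C_\phi f=f\circ\phi$; it is bounded on $H^2(\mathbb{D})$. A conjugation on a Hilbert space $\mathcal{H}$ is a conjugate-linear map $J:\mathcal{H}\to\mathcal{H}$ with $\langle Jf,Jg\rangle=\langle g,f\rangle$ for all $f,g\in\mathcal{H}$ and $J^2=I$. A bounded operator $T$ on $\mathcal{H}$ is complex symmetric if $JT=T^*J$ for some conjugation $J$ on $\mathcal{H}$. A sequence $(f_n)_{n\in\mathbb{N}}$ in $\mathcal{H}$ is conjugate-orthogonal if there is a conjugation $J$ on $\mathcal{H}$ with $\langle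 Jf_n,f_m\rangle=0$ for all $n\ne m$. Here $\phi_a^n$ denotes the pointwise $n$-th power, with $\phi_a^0=1$. *)

(* Defs.v *)
From Stdlib Require Import Reals Lra Lia ClassicalEpsilon.
From Stdlib Require Import FunctionalExtensionality ProofIrrelevance.
From Coquelicot Require Import Coquelicot.
Local Open Scope C_scope.

(** * The unit disk *)

Record disk := mk_disk { disk_val :> C; disk_lt1 : (Cmod disk_val < 1)%R }.

Lemma Cmod_sq (z : C) : (Cmod z ^ 2 = Re z ^ 2 + Im z ^ 2)%R.
Proof.
unfold Cmod. rewrite pow2_sqrt; [reflexivity|].
assert (H1 := pow2_ge_0 (fst z)). assert (H2 := pow2_ge_0 (snd z)). lra.
Qed.

Lemma Cmod_lt_1_sq (z : C) : (Cmod z < 1)%R <-> (Cmod z ^ 2 < 1)%R.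
Proof. assert (H := Cmod_ge_0 z). split; intro; nra. Qed.

Lemma mobius_identity (a z : C) :
  (Cmod (1 - Cconj a * z) ^ 2 - Cmod (a - z) ^ 2
     = (1 - Cmod a ^ 2) * (1 - Cmod z ^ 2))%R.
Proof. rewrite !Cmod_sq. destruct a as [a1 a2], z as [z1 z2]. simpl. ring. Qed.

Lemma mobius_den_neq0 (a z : disk) : 1 - Cconj a * z <> 0.
Proof.
intro H. assert (E := mobius_identity a z). rewrite H, Cmod_0 in E.
assert (Ha := proj1 (Cmod_lt_1_sq a) (disk_lt1 a)).
assert (Hz := proj1 (Cmod_lt_1_sq z) (disk_lt1 z)).
assert (P := pow2_ge_0 (Cmod (a - z))). nra.
Qed.

Lemma mobius_lt1 (a z : disk) : (Cmod ((a - z) / (1 - Cconj a * z)) < 1)%R.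
Proof.
assert (Hd := mobius_den_neq0 a z).
rewrite Cmod_div by exact Hd.
assert (Hd' := proj1 (Cmod_gt_0 _) Hd).
apply Rlt_div_l; [exact Hd'|]. rewrite Rmult_1_l.
apply Rsqr_incrst_0; try apply Cmod_ge_0.
assert (E := mobius_identity a z).
assert (Ha := proj1 (Cmod_lt_1_sq a) (disk_lt1 a)).
assert (Hz := proj1 (Cmod_lt_1_sq z) (disk_lt1 z)).
unfold Rsqr. nra.
Qed.

Definition mobius (a z : disk) : disk :=
  mk_disk ((a - z) / (1 - Cconj a * z)) (mobius_lt1 a z).

Lemma dilation_lt1 (l z : disk) : (Cmod (l * z) < 1)%R.
Proof.
rewrite Cmod_mult.
assert (Hl := disk_lt1 l). assert (Hz := disk_lt1 z).
assert (Pl := Cmod_ge_0 l). assert (Pz := Cmod_ge_0 z). nra.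
Qed.

Definition dilation (l z : disk) : disk := mk_disk (l * z) (dilation_lt1 l z).

Definition Phi (a l z : disk) : disk := mobius a (dilation l (mobius a z)).

(** * The Hardy space of the disk *)

(** An element is a function on the disk together with its Taylor coefficients
    at 0, which it determines: see [hardy_ext]. *)
Record hardy := mk_hardy {
  hardy_fun :> disk -> C;
  hardy_coef : nat -> C;
  hardy_taylor : forall z : disk,
    @is_pseries C_AbsRing C_NormedModule hardy_coef (disk_val z) (hardy_fun z);
  hardy_summable : ex_series (fun n => (Cmod (hardy_coef n) ^ 2)%R) }.

Definition hardy_zero : hardy.
Proof.
exists (fun _ => RtoC 0) (fun _ => RtoC 0).
- intro z. apply (filterlim_ext (fun _ => RtoC 0)); [|apply filterlim_const].
  intro n. induction n as [|n IH].
  + rewrite sum_O. symmetry. apply (@scal_zero_r C_AbsRing C_NormedModule).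
  + rewrite sum_Sn, <- IH, (@scal_zero_r C_AbsRing C_NormedModule).
    symmetry. apply (@plus_zero_r C_NormedModule).
- apply (ex_series_ext (fun n => 0 * (1/2) ^ n)%R).
  + intro n. rewrite Cmod_0. simpl. ring.
  + apply (@ex_series_scal_l R_AbsRing R_NormedModule 0%R). apply ex_series_geom.
    rewrite Rabs_pos_eq; lra.
Defined.

Definition hardy_add (f g : hardy) : hardy.
Proof.
exists (fun z => f z + g z) (fun n => hardy_coef f n + hardy_coef g n).
- intro z.
  exact (@is_pseries_plus C_AbsRing C_NormedModule _ _ _ _ _
           (hardy_taylor f z) (hardy_taylor g z)).
- apply (@ex_series_le R_AbsRing R_CompleteNormedModule _
    (fun n => 2 * (Cmod (hardy_coef f n) ^ 2 + Cmod (hardy_coef g n) ^ 2))%R).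
  + intro n. change norm with Rabs.
    rewrite Rabs_pos_eq by apply pow2_ge_0.
    assert (T := Cmod_triangle (hardy_coef f n) (hardy_coef g n)).
    assert (P := Cmod_ge_0 (hardy_coef f n + hardy_coef g n)).
    assert (Q := pow2_ge_0 (Cmod (hardy_coef f n) - Cmod (hardy_coef g n))).
    nra.
  + apply (@ex_series_scal_l R_AbsRing R_NormedModule 2%R).
    apply (@ex_series_plus R_AbsRing R_NormedModule _ _
             (hardy_summable f) (hardy_summable g)).
Defined.

Definition hardy_scal (c : C) (f : hardy) : hardy.
Proof.
exists (fun z => c * f z) (fun n => c * hardy_coef f n).
- intro z.
  apply (@is_pseries_scal C_AbsRing C_NormedModule); [|apply hardy_taylor].
  apply Cmult_comm.
- apply (ex_series_ext (fun n => Cmod c ^ 2 * Cmod (hardy_coef f n) ^ 2)%R).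
  + intro n. rewrite Cmod_mult. symmetry. apply Rpow_mult_distr.
  + apply (@ex_series_scal_l R_AbsRing R_NormedModule (Cmod c ^ 2)%R). apply hardy_summable.
Defined.

Definition Cseries (u : nat -> C) : C :=
  (Series (fun n => Re (u n)), Series (fun n => Im (u n))).

Definition hardy_inner (f g : hardy) : C :=
  Cseries (fun n => hardy_coef f n * Cconj (hardy_coef g n)).

Lemma sum_n_pair (u : nat -> C) (n : nat) :
  sum_n u n = (sum_n (fun k => Re (u k)) n, sum_n (fun k => Im (u k)) n) :> C.
Proof.
induction n as [|n IH].
- rewrite !sum_O. apply surjective_pairing.
- rewrite !sum_Sn, IH. reflexivity.
Qed.

Lemma is_series_Cseries (u : nat -> C) :
  ex_series (fun n => Re (u n)) -> ex_series (fun n => Im (u n)) ->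
  @is_series C_AbsRing C_NormedModule u (Cseries u).
Proof.
intros H1 H2. apply Series_correct in H1, H2.
apply (filterlim_ext
  (fun n => (sum_n (fun k => Re (u k)) n, sum_n (fun k => Im (u k)) n) : C)).
{ intro n. symmetry. apply sum_n_pair. }
apply filterlim_locally. intro eps.
assert (L1 := proj1 (filterlim_locally _ _) H1 eps).
assert (L2 := proj1 (filterlim_locally _ _) H2 eps).
generalize (filter_and _ _ L1 L2). apply filter_imp.
intros n [B1 B2]. split; assumption.
Qed.

(** The series defining the inner product always converges. *)
Lemma hardy_inner_is_series (f g : hardy) :
  @is_series C_AbsRing C_NormedModule
    (fun n => hardy_coef f n * Cconj (hardy_coef g n)) (hardy_inner f g).
Proof.
assert (D : ex_series
  (fun n => Cmod (hardy_coef f n) ^ 2 + Cmod (hardy_coef g n) ^ 2)%R).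
{ apply (@ex_series_plus R_AbsRing R_NormedModule _ _
             (hardy_summable f) (hardy_summable g)). }
apply is_series_Cseries;
  refine (@ex_series_le R_AbsRing R_CompleteNormedModule _ _ _ D);
  intro n; change norm with Rabs; rewrite !Cmod_sq;
  destruct (hardy_coef f n) as [p q], (hardy_coef g n) as [r s]; simpl;
  pose proof (pow2_ge_0 (p - r)); pose proof (pow2_ge_0 (p + r));
  pose proof (pow2_ge_0 (q - s)); pose proof (pow2_ge_0 (q + s));
  pose proof (pow2_ge_0 (q - r)); pose proof (pow2_ge_0 (q + r));
  pose proof (pow2_ge_0 (p - s)); pose proof (pow2_ge_0 (p + s));
  pose proof (pow2_ge_0 p); pose proof (pow2_ge_0 q);
  pose proof (pow2_ge_0 r); pose proof (pow2_ge_0 s);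
  apply Rabs_le; split; simpl in *; lra.
Qed.

Lemma is_series_Re (u : nat -> C) (l : C) :
  @is_series C_AbsRing C_NormedModule u l ->
  is_series (fun n => Re (u n)) (Re l) /\ is_series (fun n => Im (u n)) (Im l).
Proof.
intro H. assert (L := proj1 (filterlim_locally _ _) H).
split; apply filterlim_locally; intro eps; generalize (L eps);
  apply filter_imp; intros n B; rewrite sum_n_pair in B; apply B.
Qed.

Lemma RtoC_pow_n (x : R) (n : nat) : pow_n (K := C_Ring) (RtoC x) n = RtoC (x ^ n).
Proof.
induction n as [|n IH]; [reflexivity|].
simpl pow_n. rewrite IH. simpl pow. now rewrite RtoC_mult.
Qed.

Lemma CV_radius_ge (u : nat -> R) (r : R) :
  ex_series (fun n => u n * r ^ n)%R -> Rbar_le (Rabs r) (CV_radius u).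
Proof.
intro H. destruct (Rbar_le_lt_dec (Rabs r) (CV_radius u)) as [h|h]; [exact h|].
exfalso. apply (CV_disk_outside u r h). now apply ex_series_lim_0.
Qed.

Lemma hardy_coef_real (f : hardy) (x : R) (hx : (Rabs x < 1)%R) :
  is_series (fun n => Re (hardy_coef f n) * x ^ n)%R
    (Re (f (mk_disk x (eq_ind_r (fun t => t < 1)%R hx (Cmod_R x))))) /\
  is_series (fun n => Im (hardy_coef f n) * x ^ n)%R
    (Im (f (mk_disk x (eq_ind_r (fun t => t < 1)%R hx (Cmod_R x))))).
Proof.
set (z := mk_disk _ _).
destruct (is_series_Re _ _ (hardy_taylor f z)) as [H1 H2].
split; [refine (is_series_ext _ _ _ _ H1)|refine (is_series_ext _ _ _ _ H2)];
  intro n; simpl disk_val; rewrite RtoC_pow_n;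
  destruct (hardy_coef f n) as [p q]; cbn; ring.
Qed.

Lemma hardy_coef_unique (f g : hardy) :
  (forall z, f z = g z) -> forall n, hardy_coef f n = hardy_coef g n.
Proof.
intros E n.
assert (h2 : (Rabs (1/2) < 1)%R) by (rewrite Rabs_pos_eq; lra).
assert (rad : forall u : nat -> R, ex_series (fun n => u n * (1/2) ^ n)%R ->
  Rbar_lt 0 (CV_radius u)).
{ intros u H. apply Rbar_lt_le_trans with (Rabs (1/2)).
  - simpl. rewrite Rabs_pos_eq; lra.
  - now apply CV_radius_ge. }
destruct (hardy_coef_real f _ h2) as [F1 F2].
destruct (hardy_coef_real g _ h2) as [G1 G2].
assert (one : (0 < 1)%R) by lra.
assert (Re (hardy_coef f n) = Re (hardy_coef g n) /\
        Im (hardy_coef f n) = Im (hardy_coef g n)) as [e1 e2].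
{ split.
  - apply (PSeries_ext_recip (fun n => Re (hardy_coef f n))
                             (fun n => Re (hardy_coef g n)));
      try (apply rad; eexists; eassumption).
    exists (mkposreal 1 one). intros x hx.
    assert (hx' : (Rabs x < 1)%R).
    { rewrite <- (Rminus_0_r x). exact hx. }
    unfold PSeries.
    rewrite (is_series_unique _ _ (proj1 (hardy_coef_real f x hx'))).
    rewrite (is_series_unique _ _ (proj1 (hardy_coef_real g x hx'))).
    now rewrite E.
  - apply (PSeries_ext_recip (fun n => Im (hardy_coef f n))
                             (fun n => Im (hardy_coef g n)));
      try (apply rad; eexists; eassumption).
    exists (mkposreal 1 one). intros x hx.
    assert (hx' : (Rabs x < 1)%R).
    { rewrite <- (Rminus_0_r x). exact hx. }
    unfold PSeries.
    rewrite (is_series_unique _ _ (proj2 (hardy_coef_real f x hx'))).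
    rewrite (is_series_unique _ _ (proj2 (hardy_coef_real g x hx'))).
    now rewrite E. }
destruct (hardy_coef f n), (hardy_coef g n). simpl in e1, e2. now subst.
Qed.

Lemma hardy_ext (f g : hardy) : (forall z, f z = g z) -> f = g.
Proof.
intro E.
assert (C := functional_extensionality _ _ (hardy_coef_unique f g E)).
assert (F := functional_extensionality _ _ E).
destruct f as [f u ft fs], g as [g v gt gs]. simpl in C, F. subst v g.
f_equal; apply proof_irrelevance.
Qed.

(** [to_hardy h] is the element of the Hardy space whose underlying function is
    [h]; if [h] is not in the Hardy space it is an unspecified element. *)
Definition to_hardy (h : disk -> C) : hardy :=
  epsilon (inhabits hardy_zero) (fun f : hardy => forall z, f z = h z).

Lemma to_hardyE (h : disk -> C) :
  (exists f : hardy, forall z, f z = h z) -> forall z, to_hardy h z = h z.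
Proof. exact (epsilon_spec (inhabits hardy_zero) _). Qed.

(** * Operators and conjugations on the Hardy space *)

(** By Littlewood's subordination principle [f] composed with an analytic
    self-map [phi] of the disk is always in the Hardy space. *)
Definition comp_op (phi : disk -> disk) (f : hardy) : hardy :=
  to_hardy (fun z => f (phi z)).

Definition is_adjoint (T S : hardy -> hardy) : Prop :=
  forall f g, hardy_inner (T f) g = hardy_inner f (S g).

Record conjugation (J : hardy -> hardy) : Prop := {
  conjugation_add : forall f g, J (hardy_add f g) = hardy_add (J f) (J g);
  conjugation_scal : forall c f,
    J (hardy_scal c f) = hardy_scal (Cconj c) (J f);
  conjugation_isometry : forall f g,
    hardy_inner (J f) (J g) = hardy_inner g f;
  conjugation_involutive : forall f, J (J f) = f }.

(** Boundedness of [T] need not be stated separately: an operator with an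
    everywhere defined adjoint is linear and bounded (Hellinger-Toeplitz), and
    every bounded operator has a unique adjoint [S]. *)
Definition complex_symmetric (T : hardy -> hardy) : Prop :=
  exists J S : hardy -> hardy,
    conjugation J /\ is_adjoint T S /\ forall f, J (T f) = S (J f).

Definition conjugate_orthogonal (f : nat -> hardy) : Prop :=
  exists J : hardy -> hardy, conjugation J /\
    forall n m : nat, n <> m -> hardy_inner (J (f n)) (f m) = 0.

Definition mobius_power (a : disk) (n : nat) : hardy :=
  to_hardy (fun z => Cpow (mobius a z) n).

(* Main.v *)
Require Import Defs.
From Stdlib Require Import Reals Lra Lia FunctionalExtensionality.
From Coquelicot Require Import Coquelicot.
Local Open Scope C_scope.

(** Write phi for [mobius a] and [<f,g>] for [hardy_inner f g].

    Since phi is an involution, composition with [Phi a l] multiplies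
    [phi^n] by [l^n], and these eigenvalues are pairwise distinct. If J makes the
    operator T complex symmetric, then J carries an eigenvector of T to an
    eigenvector of the adjoint for the conjugate eigenvalue, and such a vector
    is orthogonal to the eigenvectors of T for all other eigenvalues
    ([complex_symmetric_eigen_orthogonal]). So complex symmetry would make the
    powers of phi conjugate-orthogonal, and everything rests on refuting that.

    Suppose [<J phi^n, phi^m> = 0] for [n <> m]. The vector [J 1] is orthogonal
    to [phi^m] for all [m >= 1], and so is the reproducing kernel at a, because
    [phi(a) = 0]. The powers of phi span a dense subspace, so this determines
    [J 1] up to a factor: it is a multiple of the kernel at a. But that
    kernel is [(1 - conj a * phi) / (1 - |a|^2)], a combination of [phi^0] and
    [phi^1], and [J phi^2] is orthogonal to both. Hence [<J phi^2, J 1> = 0],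
    whereas this inner product equals [<1, phi^2>], the conjugate of
    [phi(0)^2 = a^2], which is not zero.

    Density ([mobius_powers_complete]) comes from the identity
    [K_w = conj (phi w) * phi * K_w + c * (1 - conj a * phi)] for the kernel
    [K_w] at w ([kernel_decomp]). If g is orthogonal to all powers of phi, it
    makes [<g, phi^n K_w> = phi(w) * <g, phi^(n+1) K_w>] for all n. Multiplication
    by phi is isometric, so these numbers are bounded; as [|phi(w)| < 1], they
    vanish, and the one for [n = 0] is [g(w)].

    Multiplication by phi is studied by writing [f = (1 - conj a * S) q] with S
    the shift ([hardy_div_linear]): then [phi * f = (a - S) q], which shows both
    that [phi * f] is square summable and that it has the norm of f. *)

(** * The inner product *)

Lemma inner_unique (f g : hardy) (l : C) :
  @is_series C_AbsRing C_NormedModule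
    (fun n => hardy_coef f n * Cconj (hardy_coef g n)) l ->
  hardy_inner f g = l.
Proof.
intro H. destruct (is_series_Re _ _ H) as [H1 H2].
unfold hardy_inner, Cseries.
rewrite (is_series_unique _ _ H1), (is_series_unique _ _ H2).
symmetry. apply surjective_pairing.
Qed.

Lemma inner_add_l (f g h : hardy) :
  hardy_inner (hardy_add f g) h = hardy_inner f h + hardy_inner g h.
Proof.
apply inner_unique.
eapply is_series_ext;
  [|exact (is_series_plus _ _ _ _ (hardy_inner_is_series f h)
                                  (hardy_inner_is_series g h))].
intro n. symmetry. apply (Cmult_plus_distr_r (hardy_coef f n)).
Qed.

Lemma inner_scal_l (c : C) (f h : hardy) :
  hardy_inner (hardy_scal c f) h = c * hardy_inner f h.
Proof.
apply inner_unique.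
eapply is_series_ext;
  [|exact (is_series_scal c _ _ (hardy_inner_is_series f h))].
intro n. apply (Cmult_assoc c).
Qed.

Lemma inner_conj (f g : hardy) : hardy_inner g f = Cconj (hardy_inner f g).
Proof.
apply injective_projections; simpl; [|rewrite <- Series_opp];
  apply Series_ext; intro n;
  destruct (hardy_coef f n), (hardy_coef g n); simpl; ring.
Qed.

Lemma inner_add_r (f g h : hardy) :
  hardy_inner h (hardy_add f g) = hardy_inner h f + hardy_inner h g.
Proof.
now rewrite (inner_conj _ h), inner_add_l, Cplus_conj, <- !inner_conj.
Qed.

Lemma inner_scal_r (c : C) (f h : hardy) :
  hardy_inner h (hardy_scal c f) = Cconj c * hardy_inner h f.
Proof.
now rewrite (inner_conj _ h), inner_scal_l, Cmult_conj, <- inner_conj.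
Qed.

Lemma inner_self_ge0 (f : hardy) : (0 <= Re (hardy_inner f f))%R.
Proof.
destruct (is_series_Re _ _ (hardy_inner_is_series f f)) as [H _].
assert (P : forall n,
  (0 <= Re (hardy_coef f n * Cconj (hardy_coef f n)))%R).
{ intro n. destruct (hardy_coef f n) as [x y]; simpl. nra. }
apply Rle_trans with (1 := P O).
apply is_series_Reals in H. exact (sum_incr _ 0 _ H P).
Qed.

(** The quadratic [t -> <f - t x g, f - t x g>] with [x = <f,g>] is nonnegative;
    including x in the coefficient makes its linear term [-2 t |x|^2] real. *)
Lemma cauchy_schwarz (f g : hardy) :
  (Cmod (hardy_inner f g) ^ 2
     <= Re (hardy_inner f f) * Re (hardy_inner g g))%R.
Proof.
assert (Q : forall t : R, (0 <= Re (hardy_inner f f)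
  - 2 * t * Cmod (hardy_inner f g) ^ 2
  + t ^ 2 * Cmod (hardy_inner f g) ^ 2 * Re (hardy_inner g g))%R).
{ intro t.
  assert (P := inner_self_ge0
    (hardy_add f (hardy_scal (- RtoC t * hardy_inner f g) g))).
  rewrite inner_add_l, !inner_add_r, !inner_scal_l, !inner_scal_r,
    (inner_conj f g) in P.
  rewrite Cmod_sq. destruct (hardy_inner f g) as [x y].
  destruct (hardy_inner f f) as [u u'], (hardy_inner g g) as [v v'].
  cbn in P |- *. lra. }
assert (F := inner_self_ge0 f). assert (G := inner_self_ge0 g).
assert (X := pow2_ge_0 (Cmod (hardy_inner f g))).
revert F G X Q.
generalize (Cmod (hardy_inner f g) ^ 2)%R (Re (hardy_inner f f))
  (Re (hardy_inner g g)).
intros x u v F G X Q.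
destruct (Req_dec v 0) as [->|Hv].
- (* The quadratic is affine in t, so x must vanish: this t makes it negative. *)
  destruct (Req_dec x 0) as [->|Hx]; [lra|].
  assert (P := Q ((u + 1) / x)%R).
  replace (2 * ((u + 1) / x) * x)%R with (2 * (u + 1))%R in P by (field; lra).
  lra.
- (* The minimum of the quadratic is at t = 1 / v. *)
  assert (P := Q (/ v)%R).
  replace (u - 2 * / v * x + (/ v) ^ 2 * x * v)%R with ((u * v - x) / v)%R in P
    by (field; lra).
  assert (0 <= (u * v - x) / v * v)%R by (apply Rmult_le_pos; lra).
  replace ((u * v - x) / v * v)%R with (u * v - x)%R in H by (field; lra).
  lra.
Qed.

(** * Elements given by their coefficients, and the shift *)

Lemma hardy_of_coef (u : nat -> C) :
  ex_series (fun n => (Cmod (u n) ^ 2)%R) ->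
  exists f : hardy, forall n, hardy_coef f n = u n.
Proof.
intro H.
assert (S : forall z : disk, @is_pseries C_AbsRing C_NormedModule u (disk_val z)
  (Cseries (fun n => Cpow z n * u n))).
{ intro z.
  assert (D : ex_series (fun n => Cmod (u n) ^ 2 + (Cmod z ^ 2) ^ n)%R).
  { apply (@ex_series_plus R_AbsRing R_NormedModule); [exact H|].
    apply ex_series_geom. assert (P := proj1 (Cmod_lt_1_sq z) (disk_lt1 z)).
    rewrite Rabs_pos_eq; [exact P|apply pow2_ge_0]. }
  assert (B : forall n, (Cmod (Cpow z n * u n)
                <= Cmod (u n) ^ 2 + (Cmod z ^ 2) ^ n)%R).
  { intro n. rewrite Cmod_mult, Cmod_pow, <- pow_mult, Nat.mul_comm, pow_mult.
    assert (P1 := pow2_ge_0 (Cmod (u n) - Cmod z ^ n)).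
    assert (P2 := pow2_ge_0 (Cmod (u n))).
    assert (P3 := pow2_ge_0 (Cmod z ^ n)). nra. }
  apply (is_series_Cseries (fun n => Cpow z n * u n));
    refine (@ex_series_le R_AbsRing R_CompleteNormedModule _ _ _ D);
    intro n; change norm with Rabs; refine (Rle_trans _ _ _ _ (B n)).
  - apply Rle_trans with (2 := Rmax_Cmod _). apply Rmax_l.
  - apply Rle_trans with (2 := Rmax_Cmod _). apply Rmax_r. }
exists (mk_hardy _ u S H). reflexivity.
Qed.

Lemma hardy_ext_coef (f g : hardy) :
  (forall n, hardy_coef f n = hardy_coef g n) -> f = g.
Proof.
intro E. apply functional_extensionality in E.
apply hardy_ext. intro z.
assert (F := hardy_taylor f z). rewrite E in F.
exact (filterlim_locally_unique _ _ _ F (hardy_taylor g z)).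
Qed.

Definition hardy_shift (f : hardy) : hardy.
Proof.
exists (fun z : disk => z * f z)
  (@PS_incr_1 C_AbsRing C_NormedModule (hardy_coef f)).
- intro z. exact (is_pseries_incr_1 _ _ _ (hardy_taylor f z)).
- apply (ex_series_incr_1 (fun n => Cmod (PS_incr_1 (hardy_coef f) n) ^ 2)%R).
  exact (hardy_summable f).
Defined.

Lemma inner_shift (f g : hardy) :
  hardy_inner (hardy_shift f) (hardy_shift g) = hardy_inner f g.
Proof.
apply inner_unique.
apply (is_series_decr_1
  (fun n => hardy_coef (hardy_shift f) n * Cconj (hardy_coef (hardy_shift g) n))).
simpl. replace (plus _ _) with (hardy_inner f g);
  [exact (hardy_inner_is_series f g)|].
unfold zero, opp, plus; simpl. ring.
Qed.

Definition hardy_one : hardy.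
Proof.
exists (fun _ => RtoC 1) (fun n => match n with O => RtoC 1 | S _ => RtoC 0 end).
- intro z. apply (filterlim_ext (fun _ => RtoC 1)); [|apply filterlim_const].
  intro n. induction n as [|n IH].
  + rewrite sum_O. symmetry. apply Cmult_1_l.
  + rewrite sum_Sn, <- IH, (@scal_zero_r C_AbsRing C_NormedModule).
    symmetry. apply (@plus_zero_r C_NormedModule).
- apply ex_series_incr_1.
  apply (ex_series_ext (fun n => 0 * (1/2) ^ n)%R).
  + intro n. rewrite Cmod_0. simpl. ring.
  + apply (@ex_series_scal_l R_AbsRing R_NormedModule 0%R). apply ex_series_geom.
    rewrite Rabs_pos_eq; lra.
Defined.

(** Division by [1 - conj a * z] stays inside the Hardy space. The coefficients
    of the quotient satisfy [q (n+1) = conj a * q n + f (n+1)]. With [r = |a|],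
    convexity of the square applied to [r * |q n| + (1 - r) * (|f (n+1)| / (1 - r))]
    gives [|q (n+1)|^2 <= r |q n|^2 + |f (n+1)|^2 / (1 - r)], and summing this
    telescopes into a bound of the sum of the [|q n|^2]. *)
Lemma hardy_div_linear (a : disk) (f : hardy) :
  exists q : hardy,
    f = hardy_add q (hardy_scal (- Cconj a) (hardy_shift q)).
Proof.
set (q := fix q n := match n with
  | O => hardy_coef f O
  | S m => Cconj a * q m + hardy_coef f (S m) end).
assert (r1 := disk_lt1 a). assert (r0 := Cmod_ge_0 a).
set (r := Cmod a) in *.
set (F := Series (fun n => Cmod (hardy_coef f n) ^ 2)%R).
assert (HF : forall n, (sum_n (fun n => Cmod (hardy_coef f n) ^ 2)%R n <= F)%R).
{ intro n. rewrite sum_n_Reals. apply sum_incr; [|intro; apply pow2_ge_0].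
  apply is_series_Reals, Series_correct, hardy_summable. }
assert (step : forall n, (Cmod (q (S n)) ^ 2
  <= r * Cmod (q n) ^ 2 + Cmod (hardy_coef f (S n)) ^ 2 / (1 - r))%R).
{ intro n. simpl q.
  assert (T := Cmod_triangle (Cconj a * q n) (hardy_coef f (S n))).
  rewrite Cmod_mult, Cmod_conj in T. fold r in T.
  assert (P := Cmod_ge_0 (Cconj a * q n + hardy_coef f (S n))).
  revert T P. generalize (Cmod (Cconj a * q n + hardy_coef f (S n)))
    (Cmod (q n)) (Cmod (hardy_coef f (S n))).
  intros w x y T P.
  apply Rle_trans with ((r * x + y) ^ 2)%R; [now apply pow_incr|].
  apply Rminus_le_0.
  replace (r * x ^ 2 + y ^ 2 / (1 - r) - (r * x + y) ^ 2)%R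
    with (r * ((1 - r) * x - y) ^ 2 / (1 - r))%R by (field; lra).
  apply Rmult_le_pos; [|apply Rlt_le, Rinv_0_lt_compat; lra].
  apply Rmult_le_pos; [exact r0|apply pow2_ge_0]. }
assert (c1 : (1 <= / (1 - r))%R).
{ rewrite <- Rinv_1 at 1. apply Rinv_le_contravar; lra. }
assert (tele : forall n,
  ((1 - r) * sum_n (fun n => Cmod (q n) ^ 2) n + r * Cmod (q n) ^ 2
     <= sum_n (fun n => Cmod (hardy_coef f n) ^ 2) n / (1 - r))%R).
{ intro n. unfold Rdiv in *. induction n as [|n IH].
  - rewrite !sum_O. change (q O) with (hardy_coef f O).
    assert (Cmod (hardy_coef f 0) ^ 2 * 1
             <= Cmod (hardy_coef f 0) ^ 2 * / (1 - r))%R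
      by (apply Rmult_le_compat_l; [apply pow2_ge_0|lra]).
    lra.
  - rewrite !sum_Sn. assert (S0 := step n). unfold plus.
    cbn -[pow q sum_n] in *. lra. }
assert (bnd : forall n, (sum_n (fun n => Cmod (q n) ^ 2) n
                           <= F / (1 - r) / (1 - r))%R).
{ intro n. apply Rle_div_r; [lra|].
  apply Rle_trans with (sum_n (fun n => Cmod (hardy_coef f n) ^ 2) n / (1 - r))%R.
  - assert (T := tele n).
    assert (0 <= r * Cmod (q n) ^ 2)%R
      by (apply Rmult_le_pos; [lra|apply pow2_ge_0]).
    lra.
  - apply Rmult_le_compat_r; [lra|apply HF]. }
destruct (hardy_of_coef q) as [h Hh].
{ destruct (ex_finite_lim_seq_incr (sum_n (fun n => Cmod (q n) ^ 2)%R)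
    (F / (1 - r) / (1 - r))%R) as [l Hl]; [|exact bnd|exists l; exact Hl].
  intro n. rewrite sum_Sn. assert (P := pow2_ge_0 (Cmod (q (S n)))).
  unfold plus. cbn -[pow q sum_n] in *. lra. }
exists h. apply hardy_ext_coef. intro n. simpl. rewrite Hh.
destruct n as [|n]; simpl.
- unfold zero; simpl. ring.
- rewrite Hh. ring.
Qed.

Lemma Cconj_RtoC (x : R) : Cconj x = x.
Proof. apply injective_projections; simpl; ring. Qed.

(** * Multiplication by a disk automorphism *)

Definition mobius_mul (a : disk) (f : hardy) : hardy :=
  to_hardy (fun z => mobius a z * f z).

(** For [f = q - conj a * z * q] the denominator of the Moebius map cancels,
    leaving [(a - z) * q]. *)
Lemma mobius_mul_div (a : disk) (q : hardy) :
  mobius_mul a (hardy_add q (hardy_scal (- Cconj a) (hardy_shift q)))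
    = hardy_add (hardy_scal a q) (hardy_scal (- (1)) (hardy_shift q)).
Proof.
set (F := hardy_add (hardy_scal a q) _).
assert (E : forall z, F z = mobius a z
  * hardy_add q (hardy_scal (- Cconj a) (hardy_shift q)) z).
{ intro z. simpl. field. apply mobius_den_neq0. }
apply hardy_ext. intro z. unfold mobius_mul. rewrite to_hardyE.
- symmetry. apply E.
- exists F. exact E.
Qed.

Lemma mobius_mulE (a : disk) (f : hardy) (z : disk) :
  mobius_mul a f z = mobius a z * f z.
Proof.
destruct (hardy_div_linear a f) as [q ->].
rewrite mobius_mul_div. simpl. field. apply mobius_den_neq0.
Qed.

(** With [f = (1 - conj a S) q] and [g = (1 - conj a S) r], both sides expand to
    the same combination of [<q,r>], [<S q,r>] and [<q,S r>], because the shift S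
    is isometric. *)
Lemma mobius_mul_isometry (a : disk) (f g : hardy) :
  hardy_inner (mobius_mul a f) (mobius_mul a g) = hardy_inner f g.
Proof.
destruct (hardy_div_linear a f) as [q ->], (hardy_div_linear a g) as [r ->].
rewrite !mobius_mul_div, !inner_add_l, !inner_add_r, !inner_scal_l,
  !inner_scal_r, !inner_shift, !Copp_conj, Cconj_conj.
rewrite Cconj_RtoC.
ring.
Qed.

Lemma iter_mobius_mulE (a : disk) (f : hardy) (n : nat) (z : disk) :
  Nat.iter n (mobius_mul a) f z = Cpow (mobius a z) n * f z.
Proof.
induction n as [|n IH]; simpl Nat.iter.
- symmetry. apply Cmult_1_l.
- rewrite mobius_mulE, IH, Cpow_S. ring.
Qed.

Lemma iter_mobius_mul_isometry (a : disk) (f g : hardy) (n : nat) :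
  hardy_inner (Nat.iter n (mobius_mul a) f) (Nat.iter n (mobius_mul a) g)
    = hardy_inner f g.
Proof.
induction n as [|n IH]; simpl; [reflexivity|].
now rewrite mobius_mul_isometry.
Qed.

Lemma mobius_powerE (a : disk) (n : nat) (z : disk) :
  mobius_power a n z = Cpow (mobius a z) n.
Proof.
apply (to_hardyE (fun z => Cpow (mobius a z) n)).
exists (Nat.iter n (mobius_mul a) hardy_one). intro w.
rewrite iter_mobius_mulE. apply Cmult_1_r.
Qed.

(** * Reproducing kernels *)

(** The kernel [1 / (1 - conj w * z)] at w is the quotient of 1 by
    [1 - conj w * z]; its coefficients are the powers of [conj w], so the inner
    product with it is the Taylor series at w. *)
Lemma kernel_exists (w : disk) :
  exists K : hardy, (forall z : disk, (1 - Cconj w * z) * K z = 1) /\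
    forall f : hardy, hardy_inner f K = f w.
Proof.
destruct (hardy_div_linear w hardy_one) as [K E]. exists K. split.
- intro z. assert (H := f_equal (fun f : hardy => f z) E). simpl in H.
  transitivity (K z + - Cconj w * (z * K z)); [ring|now symmetry].
- assert (P : forall n, hardy_coef K n = Cpow (Cconj w) n).
  { intro n. assert (H := f_equal (fun f : hardy => hardy_coef f n) E).
    simpl in H. revert H. induction n as [|n IH]; simpl; intro H.
    - rewrite H. unfold zero; simpl. ring.
    - rewrite <- IH; [|exact (f_equal (fun f : hardy => hardy_coef f n) E)].
      replace (hardy_coef K (S n))
        with (RtoC 0 + Cconj w * hardy_coef K n) by (rewrite H; ring).
      ring. }
  intro f. apply inner_unique.
  refine (is_series_ext _ _ _ _ (hardy_taylor f w)).
  intro n. rewrite P, Cpow_conj, Cconj_conj. apply Cmult_comm.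
Qed.

(** The kernel of the space [phi * H^2] is
    [conj (phi w) * phi z * K_w z], so this identity splits [K_w] along
    [phi * H^2] and its orthogonal complement, the line spanned by the kernel at
    a, which is proportional to [1 - conj a * phi]. *)
Lemma kernel_decomp (a w : disk) (K : hardy) :
  (forall z : disk, (1 - Cconj w * z) * K z = 1) -> forall z,
  K z = Cconj (mobius a w) * (mobius a z * K z)
        + / (1 - a * Cconj w) * (1 - Cconj a * mobius a z).
Proof.
intros HK z.
assert (Hw := mobius_den_neq0 w z).
assert (Ha := mobius_den_neq0 a z).
assert (Haw : 1 - a * Cconj w <> 0).
{ rewrite Cmult_comm. apply mobius_den_neq0. }
assert (Hwa := mobius_den_neq0 a w).
replace (K z) with (/ (1 - Cconj w * z)).
2:{ transitivity (/ (1 - Cconj w * z) * ((1 - Cconj w * z) * K z)).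
    - now rewrite HK, Cmult_1_r.
    - field. exact Hw. }
simpl disk_val. rewrite Cdiv_conj by exact Hwa.
rewrite !Cminus_conj, Cmult_conj, Cconj_conj.
rewrite Cconj_RtoC.
field. repeat split; assumption.
Qed.

(** * Completeness *)

Lemma geometric_bounded_eq0 (c : C) (x : nat -> C) (B : R) :
  (Cmod c < 1)%R -> (forall n, x n = c * x (S n)) ->
  (forall n, (Cmod (x n) <= B)%R) -> x O = 0.
Proof.
intros Hc Hx HB.
assert (E : forall n, x O = Cpow c n * x n).
{ intro n. induction n as [|n IH]; [symmetry; apply Cmult_1_l|].
  rewrite IH, (Hx n), Cpow_S. ring. }
apply Cmod_eq_0, Rle_antisym; [|apply Cmod_ge_0].
assert (L : is_lim_seq (fun n => Cmod c ^ n * B)%R 0%R).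
{ replace (Finite 0) with (Rbar_mult 0 B) by (simpl; f_equal; ring).
  apply is_lim_seq_scal_r, is_lim_seq_geom.
  rewrite Rabs_pos_eq; [exact Hc|apply Cmod_ge_0]. }
refine (is_lim_seq_le _ _ _ _ _ (is_lim_seq_const (Cmod (x O))) L).
intro n. rewrite (E n), Cmod_mult, Cmod_pow.
apply Rmult_le_compat_l; [apply pow_le, Cmod_ge_0|apply HB].
Qed.

(** Iterating [kernel_decomp] pushes [<g, K_w>] into the spaces [phi^n * H^2],
    where it is damped by [phi(w)^n]. *)
Lemma mobius_powers_complete (a : disk) (g : hardy) :
  (forall m, hardy_inner g (mobius_power a m) = 0) -> forall w, g w = 0.
Proof.
intros Hg w. destruct (kernel_exists w) as [K [HK RK]].
rewrite <- RK.
apply (geometric_bounded_eq0 (mobius a w)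
  (fun n => hardy_inner g (Nat.iter n (mobius_mul a) K))
  (* The summand 1 serves to pass from a bound B of the square of the modulus
     to the bound B + 1 of the modulus. *)
  (Re (hardy_inner g g) * Re (hardy_inner K K) + 1)).
- apply disk_lt1.
- intro n.
  assert (E : Nat.iter n (mobius_mul a) K =
    hardy_add
      (hardy_scal (Cconj (mobius a w)) (Nat.iter (S n) (mobius_mul a) K))
      (hardy_scal (/ (1 - a * Cconj w))
        (hardy_add (mobius_power a n)
          (hardy_scal (- Cconj a) (mobius_power a (S n)))))).
  { apply hardy_ext. intro z.
    cbn -[mobius mobius_power Nat.iter Cpow].
    rewrite !iter_mobius_mulE, !mobius_powerE, !Cpow_S.
    rewrite (kernel_decomp a w K HK z) at 1. ring. }
  rewrite E at 1.
  rewrite inner_add_r, !inner_scal_r, inner_add_r, inner_scal_r, !Hg, Cconj_conj.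
  ring.
- intro n. assert (CS := cauchy_schwarz g (Nat.iter n (mobius_mul a) K)).
  rewrite iter_mobius_mul_isometry in CS.
  assert (P := Cmod_ge_0 (hardy_inner g (Nat.iter n (mobius_mul a) K))). nra.
Qed.

(** * The powers of a disk automorphism are not conjugate-orthogonal *)

Lemma mobius_self (a : disk) : disk_val (mobius a a) = 0.
Proof. simpl. field. apply mobius_den_neq0. Qed.

Lemma kernel_mobius_power (a : disk) (K : hardy) :
  (forall z : disk, (1 - Cconj a * z) * K z = 1) ->
  K = hardy_scal (/ (1 - a * Cconj a))
        (hardy_add (mobius_power a 0)
                   (hardy_scal (- Cconj a) (mobius_power a 1))).
Proof.
intro HK. apply hardy_ext. intro z.
rewrite (kernel_decomp a a K HK z), mobius_self.
cbn -[mobius mobius_power Cpow]. rewrite !mobius_powerE.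
rewrite Cconj_RtoC, Cpow_1_r. change (Cpow (mobius a z) 0) with (RtoC 1). ring.
Qed.

(** The kernel K at a is orthogonal to all positive powers of phi, and
    [<K, 1> = 1], so [w - <w, 1> K] is orthogonal to every power. *)
Lemma orthogonal_positive_powers (a : disk) (K w : hardy) :
  (forall f : hardy, hardy_inner f K = f a) ->
  (forall m, hardy_inner w (mobius_power a (S m)) = 0) ->
  w = hardy_scal (hardy_inner w (mobius_power a 0)) K.
Proof.
intros RK Hw. set (c := hardy_inner w (mobius_power a 0)).
assert (Kp : forall m, hardy_inner K (mobius_power a m) = Cconj (Cpow 0 m)).
{ intro m. now rewrite inner_conj, RK, mobius_powerE, mobius_self. }
apply hardy_ext. intro z. simpl.
assert (Z : w z + - c * K z = 0).
{ apply (mobius_powers_complete a (hardy_add w (hardy_scal (- c) K))).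
  intro m. rewrite inner_add_l, inner_scal_l, Kp. destruct m as [|m].
  - fold c. simpl Cpow. rewrite Cconj_RtoC. ring.
  - rewrite Hw, Cpow_S, Cmult_0_l, Cconj_RtoC. ring. }
rewrite <- (Cplus_0_l (c * K z)), <- Z. ring.
Qed.

(** The constant function 1 is the kernel at 0, and [phi(0) = a]. *)
Lemma inner_mobius_power_one (a : disk) (m : nat) :
  hardy_inner (mobius_power a m) (mobius_power a 0) = Cpow a m.
Proof.
destruct (kernel_exists (mk_disk 0 ltac:(rewrite Cmod_0; lra))) as [K [HK RK]].
assert (E : K = mobius_power a 0).
{ apply hardy_ext. intro z. rewrite mobius_powerE. simpl Cpow.
  rewrite <- (HK z). simpl disk_val. rewrite Cconj_RtoC. ring. }
rewrite <- E, RK, mobius_powerE. f_equal.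
simpl. field.
Qed.

Lemma mobius_powers_not_conjugate_orthogonal (a : disk) :
  disk_val a <> RtoC 0 -> ~ conjugate_orthogonal (mobius_power a).
Proof.
intros ha [J [HJ HO]].
destruct (kernel_exists a) as [K [HK RK]].
assert (E := orthogonal_positive_powers a K (J (mobius_power a 0)) RK
               ltac:(intro m; apply HO; discriminate)).
revert E. generalize (hardy_inner (J (mobius_power a 0)) (mobius_power a 0)).
intros c E.
assert (Z : hardy_inner (J (mobius_power a 2)) (J (mobius_power a 0)) = 0).
{ rewrite E, (kernel_mobius_power a K HK), !inner_scal_r, inner_add_r,
    inner_scal_r, !HO by discriminate.
  ring. }
rewrite (conjugation_isometry J HJ), inner_conj, inner_mobius_power_one in Z.
apply (f_equal Cconj) in Z. rewrite Cconj_conj, Cconj_RtoC in Z.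
exact (Cpow_nz a 2 ha Z).
Qed.

(** * Complex symmetry and the eigenvectors of the composition operator *)

Lemma mobius_involutive (a z : disk) : disk_val (mobius a (mobius a z)) = z.
Proof.
assert (H := mobius_den_neq0 a z).
assert (H' := mobius_den_neq0 a (mobius a z)).
assert (Ha := mobius_den_neq0 a a).
simpl in *.
replace (1 - Cconj a * ((a - z) / (1 - Cconj a * z)))
  with ((1 - Cconj a * a) / (1 - Cconj a * z)) by (field; exact H).
field. split; assumption.
Qed.

Lemma comp_Phi_mobius_power (a l : disk) (n : nat) :
  comp_op (Phi a l) (mobius_power a n)
    = hardy_scal (Cpow l n) (mobius_power a n).
Proof.
assert (E : forall z, hardy_scal (Cpow l n) (mobius_power a n) z
                        = mobius_power a n (Phi a l z)).
{ intro z. cbn -[mobius_power Cpow Phi mobius]. rewrite !mobius_powerE.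
  unfold Phi. rewrite mobius_involutive. symmetry. apply Cpow_mult_l. }
apply hardy_ext. intro z. unfold comp_op. rewrite to_hardyE.
- symmetry. apply E.
- eexists. exact E.
Qed.

Lemma disk_pow_inj (l : disk) (n m : nat) :
  disk_val l <> RtoC 0 -> Cpow l n = Cpow l m -> n = m.
Proof.
intros hl H. apply (f_equal Cmod) in H. rewrite !Cmod_pow in H.
assert (P := proj1 (Cmod_gt_0 _) hl). assert (Q := disk_lt1 l).
assert (L : forall i j, (i < j)%nat -> (Cmod l ^ j < Cmod l ^ i)%R).
{ intros i j Hij. replace j with (i + (S (j - i - 1)))%nat by lia.
  rewrite pow_add.
  assert (A := pow_lt _ i P).
  assert (B : (Cmod l ^ S (j - i - 1) < 1)%R).
  { apply pow_lt_1_compat; [lra|lia]. }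
  nra. }
destruct (Nat.lt_trichotomy n m) as [h|[h|h]]; [|exact h|];
  apply L in h; lra.
Qed.

(** Moving T across the inner product in [<T g, J f>] gives
    [d <g, J f> = <g, J (T f)> = c <g, J f>]; the conjugate-linearity of J and that
    of the inner product in its second argument cancel. *)
Lemma complex_symmetric_eigen_orthogonal (T J S : hardy -> hardy)
    (f g : hardy) (c d : C) :
  conjugation J -> is_adjoint T S -> (forall h, J (T h) = S (J h)) ->
  T f = hardy_scal c f -> T g = hardy_scal d g -> c <> d ->
  hardy_inner (J f) g = 0.
Proof.
intros HJ HS HT Hf Hg Hcd.
assert (E : d * hardy_inner g (J f) = c * hardy_inner g (J f)).
{ rewrite <- inner_scal_l, <- Hg, HS, <- HT, Hf, (conjugation_scal J HJ),
    inner_scal_r.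
  now rewrite Cconj_conj. }
rewrite inner_conj.
destruct (Ceq_dec (hardy_inner g (J f)) 0) as [Z|N].
- rewrite Z. apply Cconj_RtoC.
- exfalso. apply Hcd. symmetry.
  rewrite <- (Cmult_1_r d), <- (Cmult_1_r c), <- (Cinv_r _ N), !Cmult_assoc.
  now rewrite E.
Qed.

Theorem theorem1p2 :
  (forall a l : disk, disk_val a <> RtoC 0 -> disk_val l <> RtoC 0 ->
     ~ complex_symmetric (comp_op (Phi a l)))
  /\
  (forall a : disk, disk_val a <> RtoC 0 ->
     ~ conjugate_orthogonal (mobius_power a)).
Proof.
split; [|exact mobius_powers_not_conjugate_orthogonal].
intros a l ha hl [J [S [HJ [HS HT]]]].
apply (mobius_powers_not_conjugate_orthogonal a ha).
exists J. split; [exact HJ|]. intros n m Hnm.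
apply (complex_symmetric_eigen_orthogonal (comp_op (Phi a l)) J S _ _
         (Cpow l n) (Cpow l m)); try assumption.
- apply comp_Phi_mobius_power.
- apply comp_Phi_mobius_power.
- intro E. apply Hnm. exact (disk_pow_inj l n m hl E).
Qed.
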